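(* For every integer $m\ge 1$, the following equality holds in the $\mathbb{Q}$-algebra $\mathcal{A}$: \[ \gamma_{\mathcal{A}}^{\mathrm{K},m} = \gamma_{\mathcal{A}}^{\mathrm{W}} - 1 + (H_m-1)\,\ell_{\mathcal{A}}(m+1) + \sum_{j=1}^{m-1}(-1)^{m-j}\binom{m}{j}\frac{\ell_{\mathcal{A}}(j+1)}{m-j}. \]
   Context: Throughout, $p$ denotes a prime number and $\mathbb{Z}_{(p)}$ the localization of $\mathbb{Z}$ at the prime ideal $(p)$; $\mathbb{Z}/p\mathbb{Z}$ is identified with $\mathbb{Z}_{(p)}/p\mathbb{Z}_{(p)}$. The ring $\mathcal{A}$ is the quotient ring $\mathcal{A} := \left(\prod_p \mathbb{Z}/p\mathbb{Z}\right)/\left(\bigoplus_p \mathbb{Z}/p\mathbb{Z}\right)$, where $p$ runs over all primes. An element of $\mathcal{A}$ is written $(a_p \bmod p)_p$; it is determined by its components for all but finitely many $p$, so finitely many $p$-components may be ignored or left undefined. $\mathbb{Q}$ is embedded diagonally in $\mathcal{A}$ (a rational number $r$ is sent to $(r \bmod p)_p$, ignoring the primes dividing its denominator), and $\mathcal{A}$ is thereby a $\mathbb{Q}$-algebra. $H_m := \sum_{j=1}^m \frac1j$ is the $m$th harmonic number. Wilson quotient: $W_p := \dfrac{(p-1)!+1}{p}\in\mathbb{Z}$, and $\gamma_{\mathcal{A}}^{\mathrm{W}} := (W_p \bmod p)_p\in\mathcal{A}$. Fermat quotient: for a non-zero rational number $x$ whose numerator and denominator are both prime to $p$, $q_p(x)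 := \dfrac{x^{p-1}-1}{p}\in\mathbb{Z}_{(p)}$. For $x\in\mathbb{Q}^\times$, $\log_{\mathcal{A}}(x) := (q_p(x)\bmod p)_p\in\mathcal{A}$ and $\ell_{\mathcal{A}}(x) := x\log_{\mathcal{A}}(x)\in\mathcal{A}$. Gregory coefficients: the rational numbers $G_n$ ($n\ge 1$) are defined by $\dfrac{x}{\log(1+x)} = 1+\sum_{n=1}^\infty G_n x^n$. For $1\le n\le p-2$ the number $G_n$ lies in $\mathbb{Z}_{(p)}$. For each integer $m\ge 1$, \[ \gamma_{\mathcal{A}}^{\mathrm{K},m} := \left(m!\sum_{n=1}^{p-m-1}\frac{|G_n|}{n(n+1)\cdots(n+m)} \bmod p\right)_p + H_m - \ell_{\mathcal{A}}(m+1)\in\mathcal{A}, \] where $|\cdot|$ is the usual absolute value. An empty sum is $0$. *)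

(* Defs.v *)
From HB Require Import structures.
From mathcomp Require Import all_boot all_order all_algebra ring_quotient.
From mathcomp Require Import boolp classical_sets cardinality.
Set Implicit Arguments.
Unset Strict Implicit.
Unset Printing Implicit Defensive.
Import Order.TTheory GRing.Theory Num.Theory.
Local Open Scope ring_scope.

Definition primeT := {p : nat | prime p}.

(* 'F_p is 'Z_p when p is prime. The alias carries the pointwise ring
   structure. *)
Definition prodFp : Type := forall p : primeT, 'F_(val p).

HB.instance Definition _ := gen_eqMixin prodFp.
HB.instance Definition _ := gen_choiceMixin prodFp.

Section ProdRing.
Implicit Types f g h : prodFp.

Definition prod_zero : prodFp := fun=> 0.
Definition prod_one : prodFp := fun=> 1.
Definition prod_opp f : prodFp := fun p => - f p.
Definition prod_add f g : prodFp := fun p => f p + g p.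
Definition prod_mul f g : prodFp := fun p => f p * g p.

Fact prod_addA : associative prod_add.
Proof. by move=> f g h; apply: functional_extensionality_dep => p; exact: addrA. Qed.
Fact prod_addC : commutative prod_add.
Proof. by move=> f g; apply: functional_extensionality_dep => p; exact: addrC. Qed.
Fact prod_add0 : left_id prod_zero prod_add.
Proof. by move=> f; apply: functional_extensionality_dep => p; exact: add0r. Qed.
Fact prod_addN : left_inverse prod_zero prod_opp prod_add.
Proof. by move=> f; apply: functional_extensionality_dep => p; exact: addNr. Qed.
HB.instance Definition _ :=
  GRing.isZmodule.Build prodFp prod_addA prod_addC prod_add0 prod_addN.

Fact prod_mulA : associative prod_mul.
Proof. by move=> f g h; apply: functional_extensionality_dep => p; exact: mulrA. Qed.
Fact prod_mulC : commutative prod_mul.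
Proof. by move=> f g; apply: functional_extensionality_dep => p; exact: mulrC. Qed.
Fact prod_mul1 : left_id prod_one prod_mul.
Proof. by move=> f; apply: functional_extensionality_dep => p; exact: mul1r. Qed.
Fact prod_mulDl : left_distributive prod_mul prod_add.
Proof. by move=> f g h; apply: functional_extensionality_dep => p; exact: mulrDl. Qed.
Fact prod_one_neq0 : prod_one != prod_zero.
Proof.
apply/eqP => /(congr1 (fun f : prodFp => f (exist _ 2%N isT))) /eqP.
by rewrite oner_eq0.
Qed.
HB.instance Definition _ := GRing.Zmodule_isComNzRing.Build prodFp
  prod_mulA prod_mulC prod_mul1 prod_mulDl prod_one_neq0.

Lemma prod_addE f g p : (f + g) p = f p + g p. Proof. by []. Qed.
Lemma prod_oppE f p : (- f) p = - f p. Proof. by []. Qed.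
Lemma prod_mulE f g p : (f * g) p = f p * g p. Proof. by []. Qed.

End ProdRing.

(* The direct sum, as an ideal of the product. *)
Definition finsupp : {pred prodFp} :=
  fun f => `[< finite_set [set p | f p != 0]%classic >].

Lemma finsuppP (f : prodFp) :
  reflect (exists N, forall p : primeT, (N < val p)%N -> f p = 0) (f \in finsupp).
Proof.
apply: (iffP (asboolP _)) => [/finite_seqP[s Es]|[N fN]].
  exists (\max_(p <- s) val p)%N => p ltp; apply/eqP; apply: contraLR ltp.
  move=> fp0; have : p \in s.
    by move/seteqP: Es => -[+ _] => /(_ p) /=; apply.
  by rewrite -leqNgt => ps; rewrite (leq_bigmax_seq (F := val)).
pose s : seq primeT := pmap insub (iota 0 N.+1).
apply: (@sub_finite_set _ _ [set` s]%classic); last by apply/finite_seqP; exists s.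
move=> p /= fp0; rewrite /s mem_pmap_sub mem_iota /= add0n ltnS leqNgt.
by apply: contra fp0 => /fN ->.
Qed.

Fact finsupp_closed : idealr_closed finsupp.
Proof.
split=> [||f g h /finsuppP[N gN] /finsuppP[M hM]].
- by apply/finsuppP; exists 0%N.
- apply/finsuppP => -[N] eq10.
  have [p ltNp p_pr] := prime_above N.
  by move: (eq10 (exist _ p p_pr) ltNp) => /eqP; rewrite oner_eq0.
- apply/finsuppP; exists (maxn N M) => p; rewrite gtn_max => /andP[ltN ltM].
  by rewrite prod_addE prod_mulE gN // hM // mulr0 addr0.
Qed.
HB.instance Definition _ := isIdealr.Build prodFp finsupp finsupp_closed.

Definition calA : Type := {ideal_quot finsupp}.
HB.instance Definition _ := GRing.ComNzRing.on calA.

(* The element (f_p mod p)_p of calA. *)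
Definition toA (f : forall p : primeT, 'F_(val p)) : calA :=
  (\pi_({ideal_quot finsupp}) (f : prodFp))%qT.

Lemma toA_eqP (f g : prodFp) :
  toA f = toA g <-> exists N, forall p : primeT, (N < val p)%N -> f p = g p.
Proof.
rewrite /toA; split.
  move/eqP; rewrite -Quotient.idealrBE => /finsuppP[N fgN].
  by exists N => p /fgN /eqP; rewrite subr_eq0 => /eqP.
case=> N fgN; apply/eqP; rewrite -Quotient.idealrBE; apply/finsuppP.
by exists N => p /fgN fgp; rewrite prod_addE prod_oppE fgp subrr.
Qed.

Lemma toA1 : toA (fun=> 1) = 1.
Proof. by rewrite [RHS]piE. Qed.

Lemma toAD (f g : prodFp) : toA f + toA g = toA (fun p => f p + g p).
Proof. by rewrite /toA !piE. Qed.

Lemma toAM (f g : prodFp) : toA f * toA g = toA (fun p => f p * g p).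
Proof. by rewrite /toA !piE. Qed.

(* ratr x is numq x / denq x computed in 'F_p. For x in Z_(p) it is the class
   of x in Z_(p)/pZ_(p) = Z/pZ; the value is junk when p divides denq x, which
   for a fixed x happens for only finitely many p. *)
Definition redp (p : nat) (x : rat) : 'F_p := ratr x.

Lemma redp_frac (p : nat) (n d : int) :
  d%:~R != 0 :> 'F_p -> redp p (n%:~R / d%:~R) = n%:~R / d%:~R.
Proof.
move=> d0; have d0' : d != 0 by apply: contraNneq d0 => ->.
set x : rat := n%:~R / d%:~R.
have E : numq x * d = n * denq x.
  apply: (@intr_inj rat); rewrite !rmorphM /=.
  apply/eqP; rewrite -eqr_div ?intr_eq0 ?denq_neq0 //.
  by rewrite divq_num_den.
have dvd : (denq x %| d)%Z.
  have : (denq x %| numq x * d)%Z by rewrite E dvdz_mull.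
  by rewrite Gauss_dvdzr // coprimezE coprime_sym coprime_num_den.
have x0 : (denq x)%:~R != 0 :> 'F_p.
  by apply: contra d0; case/dvdzP: dvd => k -> ; rewrite rmorphM /= => /eqP ->;
     rewrite mulr0.
by rewrite /redp /ratr; apply/eqP; rewrite eqr_div // -!rmorphM /= E.
Qed.

Lemma intrFp_neq0 (d : int) (p : primeT) :
  d != 0 -> (`|d| < val p)%N -> d%:~R != 0 :> 'F_(val p).
Proof.
move=> d0 dp; have p_pr := valP p.
rewrite -absz_eq0 -lt0n in d0.
have nz : `|d|%N%:R != 0 :> 'F_(val p).
  rewrite -(dvdn_pcharf (pchar_Fp p_pr)); apply/negP => /(dvdn_leq d0).
  by rewrite leqNgt dp.
case: d d0 dp nz => n _ _ //=; rewrite NegzE.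
by rewrite rmorphN /= oppr_eq0.
Qed.

(* The diagonal embedding of Q. *)
Definition ratA (x : rat) : calA := toA (fun p => redp (val p) x).

Lemma ratA_morph (x y : rat) :
  ratA (x + y) = ratA x + ratA y /\ ratA (x * y) = ratA x * ratA y.
Proof.
rewrite /ratA toAD toAM; set d := denq x * denq y.
have d0 : d != 0 by rewrite mulf_neq0 ?denq_neq0.
have nz (p : primeT) : (`|d| < val p)%N ->
    d%:~R != 0 :> 'F_(val p) /\
    ((denq x)%:~R != 0 :> 'F_(val p)) /\ ((denq y)%:~R != 0 :> 'F_(val p)).
  move=> ltdp; have dp := intrFp_neq0 d0 ltdp; split=> //.
  by move: dp; rewrite rmorphM /= mulf_eq0 negb_or => /andP.
have xE : x = (numq x)%:~R / (denq x)%:~R by rewrite divq_num_den.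
have yE : y = (numq y)%:~R / (denq y)%:~R by rewrite divq_num_den.
have qx : (denq x)%:~R != 0 :> rat by rewrite intr_eq0 denq_neq0.
have qy : (denq y)%:~R != 0 :> rat by rewrite intr_eq0 denq_neq0.
split; apply/toA_eqP; exists `|d|%N => p /nz[dp [xp yp]].
  have -> : x + y = (numq x * denq y + numq y * denq x)%:~R / d%:~R.
    by rewrite {1}xE {1}yE addf_div // !rmorphD !rmorphM.
  by rewrite redp_frac // /redp /ratr addf_div // !rmorphD !rmorphM.
have -> : x * y = (numq x * numq y)%:~R / d%:~R.
  by rewrite {1}xE {1}yE mulf_div !rmorphM.
by rewrite redp_frac // /redp /ratr mulf_div !rmorphM.
Qed.

Lemma ratA1 : ratA 1 = 1.
Proof.
rewrite -toA1; apply/toA_eqP; exists 0%N => p _.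
by rewrite /redp /ratr divr1.
Qed.

Section RatAlgebra.
Implicit Types (r s : rat) (a b : calA).

Definition scaleA r a : calA := ratA r * a.

Fact scaleAA r s a : scaleA r (scaleA s a) = scaleA (r * s) a.
Proof. by rewrite /scaleA (ratA_morph r s).2 mulrA. Qed.
Fact scaleA1 : left_id 1 scaleA.
Proof. by move=> a; rewrite /scaleA ratA1 mul1r. Qed.
Fact scaleADr : right_distributive scaleA +%R.
Proof. by move=> r a b; rewrite /scaleA mulrDr. Qed.
Fact scaleADl a : {morph scaleA^~ a : r s / r + s}.
Proof. by move=> r s; rewrite /scaleA (ratA_morph r s).1 mulrDl. Qed.
HB.instance Definition _ :=
  GRing.Zmodule_isLmodule.Build rat calA scaleAA scaleA1 scaleADr scaleADl.

Fact scaleAAl r a b : r *: (a * b) = (r *: a) * b.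
Proof. exact: mulrA. Qed.
HB.instance Definition _ := GRing.Lmodule_isLalgebra.Build rat calA scaleAAl.
HB.instance Definition _ := GRing.Lalgebra_isComAlgebra.Build rat calA.

Lemma alg_ratA r : r%:A = ratA r.
Proof. exact: mulr1. Qed.

End RatAlgebra.

Definition harmonic (m : nat) : rat := \sum_(1 <= j < m.+1) j%:R^-1.

(* The nat division is exact by Wilson's theorem. *)
Definition wilson_quotient (p : nat) : nat := ((p.-1)`!.+1 %/ p)%N.

Definition gammaW : calA := toA (fun p => (wilson_quotient (val p))%:R).

Definition fermat_quotient (p : nat) (x : rat) : rat := (x ^+ p.-1 - 1) / p%:R.

Definition logA (x : rat) : calA :=
  toA (fun p => redp (val p) (fermat_quotient (val p) x)).

Definition ellA (x : rat) : calA := x *: logA x.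

(* Formal power series over Q, given by their coefficients. *)
Definition fps := nat -> rat.

Definition fps_mul (a b : fps) : fps :=
  fun n => \sum_(i < n.+1) a i * b (n - i)%N.

Fixpoint fps_inv_seq (a : fps) (n : nat) : seq rat :=
  if n is k.+1 then
    let s := fps_inv_seq a k in
    rcons s (((k == 0%N)%:R - \sum_(i < k) a (k - i)%N * s`_i) / a 0%N)
  else [::].

(* The multiplicative inverse of a series with a 0 != 0. *)
Definition fps_inv (a : fps) : fps := fun n => (fps_inv_seq a n.+1)`_n.

Definition fps_log1p : fps := fun n => if n is k.+1 then (-1) ^+ k / n%:R else 0.

(* x / log(1 + x) is the inverse of log(1 + x) / x, and the latter is the
   series log(1 + x) shifted by one. See gregoryP. *)
Definition gregory : fps := fps_inv (fun n => fps_log1p n.+1).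

Lemma fps_invE (a : fps) n :
  fps_inv a n = ((n == 0%N)%:R - \sum_(i < n) a (n - i)%N * fps_inv a i) / a 0%N.
Proof.
have sz k : size (fps_inv_seq a k) = k.
  by elim: k => //= k IHk; rewrite size_rcons IHk.
have nthE k i : (i < k)%N -> (fps_inv_seq a k)`_i = fps_inv a i.
  elim: k => //= k IHk; rewrite ltnS leq_eqVlt => /orP[/eqP -> //|ltik].
  by rewrite nth_rcons sz ltik IHk.
rewrite {1}/fps_inv /= nth_rcons sz ltnn eqxx; congr ((_ - _) / _).
by apply: eq_bigr => i _; rewrite nthE.
Qed.

Lemma fps_mul_invP (a b : fps) : a 0%N != 0 ->
  (forall n, fps_mul a b n = (n == 0%N)%:R) <-> b =1 fps_inv a.
Proof.
move=> a0.
have mulE (c : fps) n :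
    fps_mul a c n = a 0%N * c n + \sum_(i < n) a (n - i)%N * c i.
  rewrite /fps_mul (reindex_inj rev_ord_inj) /= big_ord_recr /= subnn subn0.
  rewrite addrC; congr (_ + _); apply: eq_bigr => i _.
  by rewrite subKn // ltnW // ltnS ltnW.
split=> [ab n|ab n].
  elim/ltn_ind: n => n IHn; rewrite fps_invE -ab mulE.
  have -> : \sum_(i < n) a (n - i)%N * fps_inv a i = \sum_(i < n) a (n - i)%N * b i.
    by apply: eq_bigr => i _; rewrite IHn.
  by rewrite addrK mulrC mulKf.
rewrite mulE ab fps_invE mulrC divfK //.
have -> : \sum_(i < n) a (n - i)%N * b i = \sum_(i < n) a (n - i)%N * fps_inv a i.
  by apply: eq_bigr => i _; rewrite ab.
by rewrite subrK.
Qed.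

(* gregory is the only series g with log(1 + x) * g(x) = x. *)
Lemma gregoryP (g : fps) :
  (forall n, fps_mul fps_log1p g n = (n == 1%N)%:R) <-> g =1 gregory.
Proof.
have mulS n : fps_mul fps_log1p g n.+1 = fps_mul (fun n => fps_log1p n.+1) g n.
  by rewrite /fps_mul big_ord_recl mul0r add0r.
rewrite -fps_mul_invP ?divr1 ?oner_neq0 //.
split=> gP [|n]; rewrite -?mulS ?gP // ?mulS ?gP //.
by rewrite /fps_mul big_ord1 mul0r.
Qed.

Lemma gregory0 : gregory 0 = 1.
Proof. by rewrite /gregory fps_invE big_ord0 subr0 /= !divr1. Qed.

(* The range 1 <= n < p - m, with truncated subtraction, is empty for
   p <= m + 1. *)
Definition gammaK_sum (m p : nat) : rat :=
  m`!%:R * \sum_(1 <= n < p - m)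
              `|gregory n| / \prod_(0 <= i < m.+1) (n + i)%:R.

Definition gammaK (m : nat) : calA :=
  toA (fun p => redp (val p) (gammaK_sum m (val p)))
  + (harmonic m)%:A - ellA m.+1%:R.

(* Main.v *)
From HB Require Import structures.
Require Import Defs.
From mathcomp Require Import all_boot all_order all_algebra.
From mathcomp Require boolp.
From mathcomp Require Import ring lra zify.
Import Order.TTheory GRing.Theory Num.Theory.
Local Open Scope ring_scope.

(** The Gregory coefficients are integrals of binomial polynomials,
    G_n = \int_0^1 'C(X, n) dX ([gregory_integral01]), because differentiating
    (1 + x)^X = \sum_n 'C(X, n) x^n with respect to X multiplies it by
    log (1 + x) ([deriv_binom_poly]). Integrating a polynomial over [0, 1] only
    divides the coefficient of X^i by i + 1, so this makes sense over F_p as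
    well, with 1 / 0 = 0: the monomial X^(p-1) is sent to 0.

    Fix a large prime p and write |G_n| for the integral over F_p, up to sign.
    Partial fractions turn m! / (n (n+1) ... (n+m)) into the alternating sum of
    (-1)^j 'C(m, j) / (n + j), so it is enough to know, for 0 <= j <= m, the sum
    of |G_n| / (n + j) over 1 <= n < p - m. Extended to 1 <= n < p - j this sum
    is simple: since n + j = - (p - j - n) modulo p, it is a convolution, hence a
    coefficient of the identity log (1 + x) * (x / log (1 + x)) = x. It equals
    1 / j for j > 0 ([sum_gregory_abs_pos]). For j = 0 both sides of the identity
    have a polar part 1 / p, and what is left once these cancel is the Wilson
    quotient ([sum_gregory_abs_0]).

    The extra terms involve |G_(p-i)| for small i. Over F_p one has
    'C(X, p-1) = 1 - (X+1)^(p-1), and 'C(X, p-i) is obtained from it by i - 1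
    forward differences. As (X+b)^(p-1) integrates to l(b+1) - l(b), where
    l(b) = (b^p - b) / p is the value of ell_A(b) at p, |G_(p-i)| is up to sign
    the i-th forward difference of l at 1, with a correction when i = 1
    ([gregory_abs_complement]).

    Collecting the coefficients, the theorem becomes a statement about the
    Newton interpolation series N(X) = \sum_i 'C(X, i) D^i l(1) in the Q-algebra
    calA ([gammaK_sum_newton]): the sum of Gregory coefficients is
    W - H_m - 1 + N'(m). The derivative at the last node of an interpolation
    polynomial is a combination of its values with explicit rational weights
    ([deriv_newton_interpolation]), which are those of the theorem. *)

(** * Forward differences *)

Definition fwd_diff {V : zmodType} (s : nat -> V) (a : nat) : V := s a.+1 - s a.

(** The bound [M] only has to exceed [i], since 'C(i, l) = 0 for l > i. A bound
    independent of [i] allows sums over [i] and [l] to be exchanged freely.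
    The exponent i + l has the parity of i - l and is not truncated. *)
Lemma iter_fwd_diff_newton (R : nzRingType) (V : lmodType R) (s : nat -> V)
    (i M a : nat) : (i < M)%N ->
  iter i fwd_diff s a
    = \sum_(l < M) ((-1) ^+ (i + l) * 'C(i, l)%:R : R) *: s (a + l)%N.
Proof.
elim: i a => [|i IHi] a ltiM.
  case: M ltiM => // M _; rewrite big_ord_recl big1 => [|l _].
    by rewrite expr0 mul1r scale1r addr0 addn0.
  by rewrite bin0n mulr0 scale0r.
case: M ltiM IHi => // M ltiM IHi.
rewrite iterS /fwd_diff !IHi ?(ltnW ltiM) // big_ord_recr /= bin_small // mulr0 scale0r.
rewrite addr0 [in RHS]big_ord_recl [X in _ - X]big_ord_recl !bin0 opprD addrCA.
congr (_ + _).
  by rewrite addSn exprS mulN1r mulNr scaleNr.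
rewrite -sumrB; apply: eq_bigr => l _; rewrite !lift0 binS (addSnnS a) -scalerBl.
congr (_ *: _); rewrite natrD addSn !addnS !exprS !mulN1r opprK.
by rewrite mulNr opprK mulrDr addrC.
Qed.

Lemma iter_fwd_diff_shift (V : zmodType) (s : nat -> V) i a :
  iter i fwd_diff (fun b => s b.+1) a = iter i fwd_diff s a.+1.
Proof. by elim: i a => [|i IHi] a //=; rewrite /fwd_diff !IHi. Qed.

Lemma iter_fwd_diff_inv (m n : nat) : (0 < n)%N ->
  iter m fwd_diff (fun k => k%:R^-1 : rat) n
    = (-1) ^+ m * m`!%:R / \prod_(0 <= i < m.+1) (n + i)%:R.
Proof.
elim: m n => [|m IHm] n n0.
  by rewrite big_nat1 addn0 expr0 mulr1 mul1r.
rewrite iterS /fwd_diff !IHm //.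
have prodE : \prod_(0 <= i < m.+1) (n.+1 + i)%:R = 
   (\prod_(0 <= i < m.+2) (n + i)%:R) / n%:R :> rat.
  rewrite [in RHS]big_nat_recl // addn0 mulrAC mulfV ?mul1r ?pnatr_eq0 -?lt0n //.
  by apply: eq_bigr => i _; rewrite addSnnS.
rewrite prodE [in RHS]big_nat_recr //= [in LHS]big_nat_recr //=.
set P := \prod_(0 <= i < m.+1) _.
have P0 : P != 0.
  by apply: lt0r_neq0; apply: prodr_gt0 => i _; rewrite ltr0n; lia.
have n0' : n%:R != 0 :> rat by rewrite pnatr_eq0; lia.
have nm0 : (n + m.+1)%:R != 0 :> rat by rewrite pnatr_eq0; lia.
rewrite factS natrM exprS natrD in nm0 *.
field.
by rewrite P0 n0' nat1r nm0.
Qed.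

(** * Binomial polynomials and their integrals *)

Definition falling_poly (R : nzRingType) (n : nat) : {poly R} :=
  \prod_(i < n) ('X - i%:R%:P).

Section Polynomials.
Variable F : fieldType.

Definition binom_poly (n : nat) : {poly F} := n`!%:R^-1 *: falling_poly F n.

Lemma falling_polyS n : falling_poly F n.+1 = falling_poly F n * ('X - n%:R%:P).
Proof. by rewrite /falling_poly big_ord_recr. Qed.

Lemma falling_poly_shift n : falling_poly F n.+1 \Po ('X + 1) = ('X + 1) * falling_poly F n.
Proof.
rewrite /falling_poly big_ord_recl rmorphM /= comp_polyB comp_polyX comp_polyC subr0.
congr (_ * _); rewrite rmorph_prod /=; apply: eq_bigr => i _.
rewrite comp_polyB comp_polyX comp_polyC /bump /= natrD polyCD.
by ring.
Qed.

(** Pascal's rule as a polynomial identity. It only inverts n + 1, so over F_p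
    it holds for n + 1 < p, which is all the descent from 'C(X, p - 1) needs. *)
Lemma binom_poly_shift n : n.+1%:R != 0 :> F ->
  binom_poly n.+1 \Po ('X + 1) = binom_poly n.+1 + binom_poly n.
Proof.
move=> n0; rewrite /binom_poly comp_polyZ falling_poly_shift falling_polyS factS natrM invfM.
have -> : ('X + 1) * falling_poly F n
    = falling_poly F n * ('X - n%:R%:P) + n.+1%:R *: falling_poly F n.
  by rewrite -mul_polyC -[n.+1]addn1 natrD polyCD; ring.
by rewrite scalerDr scalerA mulrAC mulVf // mul1r.
Qed.

Lemma binom_poly0 : binom_poly 0 = 1.
Proof. by rewrite /binom_poly /falling_poly big_ord0 fact0 invr1 scale1r. Qed.

Lemma binom_polyS n : binom_poly n.+1 = n.+1%:R^-1 *: (binom_poly n * ('X - n%:R%:P)).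
Proof. by rewrite /binom_poly falling_polyS factS natrM invfM -scalerAl scalerA. Qed.

Lemma binom_poly_at0 n : (binom_poly n).[0] = (n == 0%N)%:R.
Proof.
case: n => [|n]; first by rewrite binom_poly0 hornerC.
rewrite /binom_poly /falling_poly big_ord_recl hornerZ hornerM hornerXsubC.
by rewrite subrr mul0r mulr0.
Qed.

(** The integral over [0, 1]. In characteristic p the monomials X^i with p
    dividing i + 1 integrate to 0, because 1 / 0 = 0; this convention is what
    makes the value at 'C(X, p - 1) below meaningful. *)
Definition integral01 (f : {poly F}) : F := \sum_(i < size f) f`_i / i.+1%:R.

Lemma integral01_wide (f : {poly F}) n : (size f <= n)%N ->
  integral01 f = \sum_(i < n) f`_i / i.+1%:R.
Proof.
move=> le_fn; rewrite /integral01 (big_ord_widen n (fun i => f`_i / i.+1%:R)) //.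
rewrite big_mkcond; apply: eq_bigr => i _; case: ltnP => // le_fi.
by rewrite nth_default // mul0r.
Qed.

Fact integral01_is_linear : linear_for *%R integral01.
Proof.
move=> c f g; pose n := maxn (size (c *: f + g)) (maxn (size f) (size g)).
rewrite !(@integral01_wide _ n) /n ?leq_max ?leqnn ?orbT // mulr_sumr -big_split.
by apply: eq_bigr => i _; rewrite coefD coefZ mulrDl mulrA.
Qed.
HB.instance Definition _ :=
  GRing.isLinear.Build F {poly F} F *%R integral01 integral01_is_linear.
End Polynomials.

Lemma integral01Z (F : fieldType) (c : F) f : integral01 F (c *: f) = c * integral01 F f.
Proof. exact: linearZ. Qed.

Lemma integral01Xn (F : fieldType) n : integral01 F 'X^n = n.+1%:R^-1.
Proof.
rewrite (@integral01_wide _ _ n.+1) ?size_polyXn // big_ord_recr big1 /= => [|i _].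
  by rewrite add0r coefXn eqxx mul1r.
by rewrite coefXn ltn_eqF // mul0r.
Qed.

(** * Gregory coefficients as integrals *)

Section Rational.
Implicit Types (n m : nat).

Let horner_X1 m : ('X + 1 : {poly rat}).[m%:R] = m.+1%:R.
Proof. by rewrite !hornerE natr1. Qed.

Lemma binom_poly_nat n m : (binom_poly rat n).[m%:R] = 'C(m, n)%:R.
Proof.
elim: m n => [|m IHm] n; first by rewrite binom_poly_at0 bin0n.
case: n => [|n]; first by rewrite binom_poly0 hornerC bin0.
have := congr1 (fun f => f.[m%:R]) (binom_poly_shift rat n (lt0r_neq0 (ltr0Sn _ _))).
by rewrite horner_comp horner_X1 hornerD !IHm binS natrD.
Qed.

(** By induction the two polynomials agree at every natural number. *)
Lemma eq_poly_of_shift (f g : {poly rat}) :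
  f \Po ('X + 1) - f = g \Po ('X + 1) - g -> f.[0] = g.[0] -> f = g.
Proof.
move=> Efg E0; apply/eqP; rewrite -subr_eq0; apply/eqP.
set h := f - g.
have h0 k : (f - g).[k%:R] = 0.
  elim: k => [|k IHk]; first by rewrite hornerD hornerN E0 subrr.
  have := congr1 (fun q => q.[k%:R]) Efg.
  rewrite !hornerD !hornerN !horner_comp horner_X1 => E.
  move/eqP: IHk; rewrite hornerD hornerN subr_eq0 => /eqP Ek.
  by move: E; rewrite Ek => /addIr ->; rewrite subrr.
apply: (@roots_geq_poly_eq0 _ h [seq k%:R | k <- iota 0 (size h)]).
- by apply/allP => x /mapP[k _ ->]; rewrite /root h0.
- by rewrite map_inj_uniq ?iota_uniq // => x y /eqP; rewrite eqr_nat => /eqP.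
- by rewrite size_map size_iota.
Qed.

Lemma deriv_binom_poly_at0 n : (binom_poly rat n.+1)^`().[0] = (-1) ^+ n / n.+1%:R.
Proof.
elim: n => [|n IHn]; rewrite binom_polyS derivZ derivM derivXsubC.
  by rewrite binom_poly0 derivC !hornerE.
rewrite mulr1 hornerZ hornerD hornerM IHn binom_poly_at0 addr0 hornerXsubC sub0r mulrN.
by rewrite mulfVK ?pnatr_eq0 // exprS mulN1r mulrC.
Qed.

(** This is d/dX (1 + x)^X = log (1 + x) (1 + x)^X, coefficient by coefficient.
    Both sides behave in the same way under forward difference, by Pascal's rule,
    and agree at 0. *)
Lemma deriv_binom_poly n : (binom_poly rat n.+1)^`()
  = \sum_(k < n.+1) ((-1) ^+ (n - k) / (n.+1 - k)%:R) *: binom_poly rat k.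
Proof.
elim: n => [|n IHn].
  by rewrite big_ord1 binom_polyS binom_poly0 !mul1r derivZ derivXsubC invr1 scale1r.
apply: eq_poly_of_shift.
  have dX : (('X + 1 : {poly rat})^`()) = 1 by rewrite derivD derivX derivC addr0.
  have -> : (binom_poly rat n.+2)^`() \Po ('X + 1) = (binom_poly rat n.+2 \Po ('X + 1))^`().
    by rewrite deriv_comp dX mulr1.
  rewrite binom_poly_shift ?pnatr_eq0 // derivD addrAC subrr add0r IHn.
  rewrite [in RHS]big_ord_recl binom_poly0 comp_polyD comp_polyZ rmorph1 opprD addrACA.
  rewrite subrr add0r linear_sum -sumrB; apply: eq_bigr => k _.
  rewrite lift0 /= comp_polyZ binom_poly_shift ?pnatr_eq0 // -scalerBr.
  by rewrite addrAC subrr add0r.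
rewrite deriv_binom_poly_at0 horner_sum big_ord_recl hornerZ binom_poly_at0.
rewrite mulr1 big1 ?addr0 //.
by move=> k _; rewrite hornerZ binom_poly_at0 lift0 mulr0.
Qed.

Lemma integral01_deriv (f : {poly rat}) : integral01 rat f^`() = f.[1] - f.[0].
Proof.
rewrite (@integral01_wide _ _ (size f).-1) ?size_poly //.
have [->|f0] := eqVneq f 0; first by rewrite size_poly0 big_ord0 !horner0 subr0.
rewrite horner_coef0 horner_coef.
have : size f = (size f).-1.+1 by rewrite prednK // size_poly_gt0.
move: (size f).-1 => n ->; rewrite big_ord_recl expr0 mulr1.
rewrite addrAC subrr add0r; apply: eq_bigr => i _.
by rewrite coef_deriv lift0 expr1n mulr1 -[f`_i.+1 *+ _]mulr_natr mulfK // pnatr_eq0.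
Qed.

(** By [deriv_binom_poly] the convolution of these integrals with the
    coefficients of log (1 + x) / x is the integral of a derivative, that is,
    'C(1, n + 1) - 'C(0, n + 1), which vanishes unless n = 0. *)
Lemma gregory_integral01 n : gregory n = integral01 rat (binom_poly rat n).
Proof.
symmetry; move: n; apply/(fps_mul_invP (fun n => integral01 rat (binom_poly rat n))).
  by rewrite /fps_log1p divr1 expr0 oner_neq0.
move=> n; rewrite /fps_mul (reindex_inj rev_ord_inj) /=.
transitivity (integral01 rat (binom_poly rat n.+1)^`()).
  rewrite deriv_binom_poly raddf_sum; apply: eq_bigr => k _.
  have lekn : (k <= n)%N by rewrite -ltnS.
  by rewrite subSS subKn // subSn // [RHS]integral01Z.
rewrite integral01_deriv (binom_poly_nat _ 1) binom_poly_at0 subr0.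
by case: n => [|n]; rewrite ?bin1 // bin_small.
Qed.
End Rational.

(** Over Q and for n > 0 this is |G_n| (see [norm_gregory]); over F_p it is the
    reduction of |G_n| for 0 < n <= p - 2, and extends it to n = p - 1, where |G_n|
    is not p-integral. *)
Definition gregory_abs (F : fieldType) (n : nat) : F :=
  - (-1) ^+ n * integral01 F (binom_poly F n).

Lemma gregory_absE n : gregory_abs rat n = - (-1) ^+ n * gregory n.
Proof. by rewrite /gregory_abs gregory_integral01. Qed.

Lemma gregory_abs_rec n : (0 < n)%N ->
  \sum_(1 <= k < n.+1) gregory_abs rat k / (n.+1 - k)%:R = n.+1%:R^-1.
Proof.
move=> n0; pose a k := fps_log1p k.+1.
have a0 : a 0%N != 0 by [].
have := (fps_mul_invP gregory a0).2 (fun=> erefl) n.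
rewrite /fps_mul (reindex_inj rev_ord_inj) /= big_ord_recl !subSS !subn0 subnn.
rewrite gregory0 mulr1 eqn0Ngt n0 => E.
rewrite big_add1 big_mkord.
have E' : (-1) ^+ n * (a n + \sum_(i < n)
   a (n - bump 0 i)%N * gregory (n - (n - bump 0 i))%N) = 0 by rewrite E mulr0.
rewrite mulrDr mulrA -expr2 sqrr_sign mul1r in E'.
move/eqP: E'; rewrite addr_eq0 => /eqP ->; rewrite -mulrN -sumrN mulr_sumr.
apply: eq_bigr => k _; have ltkn := ltn_ord k.
rewrite gregory_absE /bump add1n subKn // /a /= subSS.
have -> : (n - k.+1).+1 = (n - k)%N by lia.
have -> : (-1) ^+ n = (-1) ^+ k.+1 * (-1) ^+ (n - k.+1) :> rat.
  by rewrite -exprD subnKC.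
rewrite mulrN !mulNr; congr (- _).
rewrite -!mulrA; congr (_ * _).
by rewrite [RHS]mulrA -expr2 sqrr_sign mul1r mulrC.
Qed.

(** Kaluza's argument: the coefficients 1 / (n + 1) of - log (1 - x) / x are
    log-convex, so its inverse has nonpositive coefficients after the first.
    Subtracting the recurrence at n + 1, rescaled by (n + 2) / (n + 3), from the
    one at n + 2 leaves a combination of earlier terms with nonnegative
    weights. *)
Lemma gregory_abs_ge0 n : (0 < n)%N -> 0 <= gregory_abs rat n.
Proof.
elim/ltn_ind: n => -[//|[_ _|n IHn _]].
  have := gregory_abs_rec 1 isT; rewrite big_nat1 divr1 => ->.
  by rewrite invr_ge0.
have := gregory_abs_rec n.+2 isT; rewrite big_nat_recr //= subSnn divr1 addrC.
move/(canRL (addrK _)) => ->.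
(* rescale the recurrence at n + 1 so that its right side is 1 / (n + 3) *)
have -> : n.+3%:R^-1 = n.+2%:R / n.+3%:R * n.+2%:R^-1 :> rat.
  by rewrite mulrAC mulfV ?pnatr_eq0 // mul1r.
rewrite -(gregory_abs_rec n.+1 isT) mulr_sumr -sumrB big_nat_cond.
apply: sumr_ge0 => k /andP[/andP[k0 ltkn] _].
rewrite mulrCA -mulrBr mulr_ge0 ?IHn // subr_ge0.
have -> : n.+3%:R = n.+2%:R + 1 :> rat by rewrite -natr1.
have -> : (n.+3 - k)%:R = (n.+2 - k)%:R + 1 :> rat by rewrite natr1 -subSn 1?ltnW.
have d0 : (0 : rat) < (n.+2 - k)%:R by rewrite ltr0n subn_gt0.
have e0 : ((n.+2 - k)%:R : rat) <= n.+2%:R by rewrite ler_nat leq_subr.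
set d := (n.+2 - k)%:R in d0 e0 *; set e := n.+2%:R in e0 *.
have e1 : 0 < e by apply: lt_le_trans e0.
rewrite ler_pdivlMr // mulrC ler_pdivrMr ?addr_gt0 // mulrAC.
by rewrite ler_pdivlMr ?addr_gt0 //; nra.
Qed.

Lemma norm_gregory n : (0 < n)%N -> `|gregory n| = gregory_abs rat n.
Proof.
move=> n0; rewrite -[RHS]ger0_norm ?gregory_abs_ge0 // gregory_absE.
by rewrite mulNr normrN normrM normrX normrN1 expr1n mul1r.
Qed.

(** * Differentiating an interpolation polynomial at its last node *)

Lemma harmonicS n : harmonic n.+1 = harmonic n + n.+1%:R^-1.
Proof. by rewrite /harmonic big_nat_recr. Qed.

Lemma harmonic0 : harmonic 0 = 0.
Proof. by rewrite /harmonic big_geq. Qed.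

Lemma deriv_binom_poly_nat n m : (n <= m)%N ->
  (binom_poly rat n)^`().[m%:R] = 'C(m, n)%:R * (harmonic m - harmonic (m - n)).
Proof.
elim: n => [|n IHn] ltnm.
  by rewrite binom_poly0 derivC horner0 subn0 subrr mulr0.
rewrite binom_polyS derivZ derivM derivXsubC mulr1 hornerZ hornerD hornerM.
rewrite (IHn (ltnW ltnm)) binom_poly_nat hornerXsubC -natrB 1?ltnW //.
(* m - n = d + 1 relates both the binomials and the harmonic numbers *)
have [d Ed] : exists d, (m - n)%N = d.+1 by exists (m - n).-1; lia.
have Ed' : (m - n.+1)%N = d by lia.
have : n.+1%:R * 'C(m, n.+1)%:R = d.+1%:R * 'C(m, n)%:R :> rat.
  by rewrite -!natrM -Ed mul_bin_left.
rewrite Ed Ed' harmonicS => EC; rewrite mulrDr.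
apply: (mulfI (x := n.+1%:R)); rewrite ?pnatr_eq0 // [RHS]mulrA EC.
by field; rewrite !nat1r !pnatr_eq0.
Qed.

(** The other evaluation of the same derivative, through the expansion of
    log (1 + x). Comparing it with [deriv_binom_poly_nat] gives closed forms for
    alternating sums such as [sum_bin_inv]. *)
Lemma deriv_binom_poly_nat_log i m : (0 < i)%N ->
  (binom_poly rat i)^`().[m%:R]
    = \sum_(j < i) (-1) ^+ (i.-1 - j) / (i - j)%:R * 'C(m, j)%:R.
Proof.
case: i => // i _; rewrite deriv_binom_poly horner_sum; apply: eq_bigr => j _.
by rewrite hornerZ binom_poly_nat.
Qed.

(** The sum is the expansion of the derivative of 'C(X, m) at m, read from its
    last term to its first. *)
Lemma sum_bin_inv m :
  \sum_(j < m.+1) ((-1) ^+ j * 'C(m, j)%:R) / j%:R = - harmonic m.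
Proof.
case: m => [|m]; first by rewrite big_ord1 invr0 mulr0 harmonic0 oppr0.
have := deriv_binom_poly_nat m.+1 m.+1 (leqnn _).
rewrite subnn harmonic0 subr0 binn mul1r => <-.
rewrite deriv_binom_poly_nat_log // -sumrN (reindex_inj rev_ord_inj) big_ord_recr /=.
rewrite subnn invr0 mulr0 addr0; apply: eq_bigr => j _.
have ltjm := ltn_ord j.
rewrite subSS bin_sub 1?ltnW // subSn // exprS !mulN1r !mulNr.
by rewrite mulrAC.
Qed.

Lemma iter_fwd_diff_harmonic n : (0 < n)%N ->
  iter n fwd_diff harmonic 0 = - ((-1) ^+ n / n%:R).
Proof.
case: n => // n _; rewrite iterSr.
have -> : fwd_diff harmonic = fun a => a.+1%:R^-1.
  apply/boolp.funext => a; rewrite /fwd_diff harmonicS.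
  by rewrite addrAC subrr add0r.
rewrite (iter_fwd_diff_shift _ (fun a => a%:R^-1)) iter_fwd_diff_inv //.
have -> : \prod_(0 <= i < n.+1) (1 + i)%:R = n.+1`!%:R :> rat.
  by rewrite fact_prod big_add1 natr_prod.
rewrite exprS mulN1r mulNr opprK factS natrM; field.
have nf0 : n`!%:R != 0 :> rat by rewrite pnatr_eq0 -lt0n fact_gt0.
by rewrite nf0 nat1r pnatr_eq0.
Qed.

Lemma iter_fwd_diff_cstB (V : zmodType) (c : V) (s : nat -> V) n a : (0 < n)%N ->
  iter n fwd_diff (fun r => c - s r) a = - iter n fwd_diff s a.
Proof.
case: n => // n _; elim: n a => [|n IHn] a.
  by rewrite /= /fwd_diff !opprD !opprK addrACA subrr add0r.
by rewrite iterS /fwd_diff !IHn -opprD.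
Qed.

Lemma bin_mul_bin m l s : (l + s <= m)%N ->
  ('C(m, s + l) * 'C(s + l, l) = 'C(m, l) * 'C(m - l, s))%N.
Proof.
move=> le; have f0 k : (0 < k`!)%N := fact_gt0 k.
have e1 := @bin_fact m (s + l) ltac:(lia).
have e2 := @bin_fact (s + l) l ltac:(lia).
have e3 := @bin_fact m l ltac:(lia).
have e4 := @bin_fact (m - l) s ltac:(lia).
rewrite -subnDA [(l + s)%N]addnC addnK in e2 e4.
apply/eqP; rewrite -(eqn_pmul2r (f0 l)) -(eqn_pmul2r (f0 s)).
rewrite -(eqn_pmul2r (f0 (m - (s + l))%N)); apply/eqP.
transitivity m`!; first by rewrite -e1 -e2; ring.
by rewrite -e3 -e4; ring.
Qed.

(** The weight of the node l. Since
    'C(m, l + s) 'C(l + s, l) = 'C(m, l) 'C(m - l, s), the sum is 'C(m, l) times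
    the (m - l)-th forward difference of H_m - H at 0. *)
Lemma sum_bin_harmonic (m l : nat) : (l <= m)%N ->
  \sum_(i < m.+1) (binom_poly rat i)^`().[m%:R] * ((-1) ^+ (i + l) * 'C(i, l)%:R)
   = if l == m then harmonic m else (-1) ^+ (m - l) * 'C(m, l)%:R / (m - l)%:R.
Proof.
move=> lelm; set N := (m - l)%N.
have ltlm : (l < m.+1)%N by [].
rewrite -(big_mkord xpredT (fun i => (binom_poly rat i)^`().[m%:R]
   * ((-1) ^+ (i + l) * 'C(i, l)%:R))) (big_cat_nat (n := l)) ?leqW //=.
rewrite big_nat_cond big1 ?add0r => [|i]; last first.
  by rewrite andbT => /andP[_ ltil]; rewrite bin_small // !mulr0.
rewrite -{1}[l]add0n big_addn big_mkord subSn // -/N.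
rewrite (eq_bigr (fun s : 'I_N.+1 => 'C(m, l)%:R *
   ((-1) ^+ s * 'C(N, s)%:R * (harmonic m - harmonic (N - s)%N)))); last first.
  move=> s _; have lesN : (s <= N)%N by rewrite -ltnS.
  rewrite deriv_binom_poly_nat; last by lia.
  have -> : (m - (s + l) = N - s)%N by lia.
  rewrite -addnA addnn exprD -signr_odd -[(-1) ^+ l.*2]signr_odd odd_double mulr1.
  rewrite signr_odd.
  have : 'C(m, s + l)%:R * 'C(s + l, l)%:R = 'C(m, l)%:R * 'C(N, s)%:R :> rat.
    rewrite -!natrM; congr (_%:R).
    by apply: bin_mul_bin; lia.
  move=> E; transitivity ((-1) ^+ s * ('C(m, s + l)%:R * 'C(s + l, l)%:R)
      * (harmonic m - harmonic (N - s)%N)); first by ring.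
  by rewrite E; ring.
rewrite -mulr_sumr (reindex_inj rev_ord_inj) /=.
have E := iter_fwd_diff_newton _ rat^o (fun r => harmonic m - harmonic r)
  N N.+1 0 (ltnSn _).
rewrite (eq_bigr (fun j : 'I_N.+1 =>
  ((-1) ^+ (N + j) * 'C(N, j)%:R) *: (harmonic m - harmonic j : rat^o))); last first.
  move=> s _; have lesN : (s <= N)%N by rewrite -ltnS.
  rewrite subSS subKn // bin_sub //; congr (_ * _ * _).
  by rewrite -signr_odd oddB // -oddD signr_odd.
rewrite -E; case: eqVneq => [elm|nlm].
  by rewrite /N elm subnn binn mul1r /= harmonic0 subr0.
have N0 : (0 < N)%N by rewrite /N; lia.
rewrite iter_fwd_diff_cstB // iter_fwd_diff_harmonic // opprK.
by rewrite mulrA [_%:R * _]mulrC.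
Qed.

(** The left side is the derivative at m of the Newton form of the polynomial
    that takes the values s 0, ..., s m at 0, ..., m. *)
Lemma deriv_newton_interpolation (V : lmodType rat) (s : nat -> V) m :
  \sum_(i < m.+1) (binom_poly rat i)^`().[m%:R] *: iter i fwd_diff s 0
   = harmonic m *: s m
     + \sum_(l < m) ((-1) ^+ (m - l) * 'C(m, l)%:R / (m - l)%:R) *: s l.
Proof.
under eq_bigr => i _.
  rewrite (iter_fwd_diff_newton _ _ s i m.+1 0) // scaler_sumr.
  under eq_bigr do rewrite scalerA.
  over.
rewrite exchange_big /= (eq_bigr (fun l : 'I_m.+1 => (if l == m :> nat then harmonic m
   else (-1) ^+ (m - l) * 'C(m, l)%:R / (m - l)%:R) *: s l)) => [|l _].
  rewrite big_ord_recr /= eqxx addrC; congr (_ + _).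
  by apply: eq_bigr => l _; rewrite ltn_eqF.
by rewrite -scaler_suml sum_bin_harmonic // -ltnS.
Qed.

(** * Reduction modulo p *)

(** The graph of the reduction from p-integral rationals to F_p. Unlike the
    total function [redp], it is compatible with all the operations used below,
    p-integrality being propagated along with the value. *)
Definition reduces (p : nat) (x : rat) (y : 'F_p) : Prop :=
  exists n d : int, [/\ d%:~R != 0 :> 'F_p, x = n%:~R / d%:~R & y = n%:~R / d%:~R].

Section Reduction.
Variables (p : nat) (p_pr : prime p).
Local Notation "x ~> y" := (reduces p x y) (at level 70).

Lemma reduces_redp x y : x ~> y -> redp p x = y.
Proof. by case=> n [d [d0 -> ->]]; rewrite redp_frac. Qed.

Lemma reduces_int n : n%:~R ~> n%:~R.
Proof. by exists n, 1; rewrite rmorph1 !divr1 oner_neq0. Qed.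

Lemma reduces_nat n : n%:R ~> n%:R.
Proof. by have := reduces_int n. Qed.

Let intr_rat_neq0 (d : int) : d%:~R != 0 :> 'F_p -> d%:~R != 0 :> rat.
Proof. by rewrite intr_eq0; apply: contraNneq => ->. Qed.

Lemma reduces_opp x y : x ~> y -> - x ~> - y.
Proof. by case=> n [d [d0 -> ->]]; exists (- n), d; rewrite !rmorphN !mulNr. Qed.

Lemma reduces_add x y x' y' : x ~> y -> x' ~> y' -> x + x' ~> y + y'.
Proof.
case=> n [d [d0 -> ->]] [n' [d' [d0' -> ->]]]; exists (n * d' + n' * d), (d * d').
by rewrite !addf_div ?intr_rat_neq0 // !rmorphD !rmorphM mulf_neq0.
Qed.

Lemma reduces_mul x y x' y' : x ~> y -> x' ~> y' -> x * x' ~> y * y'.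
Proof.
case=> n [d [d0 -> ->]] [n' [d' [d0' -> ->]]]; exists (n * n'), (d * d').
by rewrite !mulf_div !rmorphM mulf_neq0.
Qed.

Lemma reduces_natV n : n%:R != 0 :> 'F_p -> n%:R^-1 ~> n%:R^-1.
Proof. by move=> n0; exists 1, n; rewrite !rmorph1 !mul1r. Qed.

Lemma reduces_sign n : (-1) ^+ n ~> (-1) ^+ n.
Proof. by have := reduces_int ((-1) ^+ n); rewrite !rmorphXn !rmorphN1. Qed.

Lemma reduces_sum (I : eqType) (r : seq I) (f : I -> rat) (g : I -> 'F_p) :
  {in r, forall i, f i ~> g i} -> \sum_(i <- r) f i ~> \sum_(i <- r) g i.
Proof.
elim: r => [|i r IHr] fg; first by rewrite !big_nil; apply: (reduces_nat 0).
rewrite !big_cons; apply: reduces_add; first by apply: fg; rewrite mem_head.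
by apply: IHr => j jr; apply: fg; rewrite inE jr orbT.
Qed.

Lemma natrFp_neq0 k : (0 < k < p)%N -> k%:R != 0 :> 'F_p.
Proof.
move=> /andP[k0 ltkp]; rewrite -(dvdn_pcharf (pchar_Fp p_pr)).
by apply/negP => /(dvdn_leq k0); rewrite leqNgt ltkp.
Qed.

Lemma factFp_neq0 n : (n < p)%N -> n`!%:R != 0 :> 'F_p.
Proof.
elim: n => [|n IHn] ltnp; first by rewrite oner_neq0.
by rewrite factS natrM mulf_neq0 ?(IHn (ltnW ltnp)) ?natrFp_neq0.
Qed.

Lemma natrFp_sub k : (k <= p)%N -> (p - k)%:R = - k%:R :> 'F_p.
Proof. by move=> lekp; rewrite natrB // pchar_Fp_0 // sub0r. Qed.
End Reduction.

Lemma size_falling_poly (R : idomainType) n : size (falling_poly R n) = n.+1.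
Proof. by rewrite /falling_poly -big_enum size_prod_XsubC -cardE card_ord. Qed.

Lemma lead_falling_poly (R : idomainType) n : (falling_poly R n)`_n = 1.
Proof.
have /monicP : falling_poly R n \is monic by rewrite /falling_poly monic_prod_XsubC.
by rewrite lead_coefE size_falling_poly.
Qed.

Lemma falling_poly_int (R : comNzRingType) n :
  falling_poly R n = map_poly intr (falling_poly int n).
Proof.
rewrite /falling_poly rmorph_prod; apply: eq_bigr => i _ /=.
by rewrite rmorphB /= map_polyX map_polyC /= natz.
Qed.

(** Both the rational integral and the one over F_p are read off the same integer
    coefficients, which is what makes reduction possible. *)
Lemma integral01_binom_poly (F : fieldType) n : integral01 F (binom_poly F n) =
  n`!%:R^-1 * \sum_(0 <= k < n.+1) ((falling_poly int n)`_k)%:~R / k.+1%:R.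
Proof.
rewrite /binom_poly integral01Z (@integral01_wide _ _ n.+1) ?size_falling_poly // big_mkord.
congr (_ * _); apply: eq_bigr => k _.
by rewrite falling_poly_int coef_map.
Qed.

Lemma reduces_gregory_abs (p n : nat) : prime p -> (n.+1 < p)%N ->
  reduces p (gregory_abs rat n) (gregory_abs 'F_p n).
Proof.
move=> p_pr ltnp; rewrite /gregory_abs !integral01_binom_poly.
apply: reduces_mul; first by apply: reduces_opp; apply: reduces_sign.
apply: reduces_mul; first by apply: reduces_natV; rewrite factFp_neq0 // ltnW.
apply: reduces_sum => k; rewrite mem_index_iota => /andP[_ ltkn].
apply: reduces_mul; first exact: reduces_int.
by apply: reduces_natV; rewrite natrFp_neq0 //; lia.
Qed.

(** * Sums of Gregory coefficients modulo p *)

Section SumAbsG.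
Variables (p : nat) (p_pr : prime p) (p_odd : (2 < p)%N).

Lemma wilson_quotientE : (wilson_quotient p * p = p.-1`!.+1)%N.
Proof. by rewrite divnK // -Wilson ?prime_gt1. Qed.

Lemma factFp_pred : p.-1`!%:R = -1 :> 'F_p.
Proof.
apply/eqP; rewrite -addr_eq0 natr1 -wilson_quotientE natrM pchar_Fp_0 //.
by rewrite mulr0.
Qed.

Lemma sign_pred (R : pzRingType) : (-1) ^+ p.-1 = 1 :> R.
Proof.
have [p2|po] := even_prime p_pr; first by move: p_odd; rewrite p2.
by rewrite -signr_odd -subn1 oddB ?prime_gt0 // po.
Qed.

(** The recurrence [gregory_abs_rec] at p - j - 1 involves |G_k| for k <= p - 2
    only, hence reduces modulo p; there p - j - k becomes - (k + j). *)
Lemma sum_gregory_abs_pos (j : nat) : (0 < j)%N -> (j.+1 < p)%N ->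
  \sum_(1 <= n < p - j) gregory_abs 'F_p n / (n + j)%:R = j%:R^-1.
Proof.
move=> j0 ltjp; pose N := (p - j.+1)%N.
have EN : (N.+1 = p - j)%N by rewrite /N; lia.
have N0 : (0 < N)%N by rewrite /N; lia.
have := gregory_abs_rec N N0; rewrite EN => E.
have Eneg (n : nat) : (n < p - j)%N -> (p - j - n)%:R = - (n + j)%:R :> 'F_p.
  by move=> ltn; rewrite -subnDA natrFp_sub //; [rewrite addnC | lia].
have H1 : reduces p (\sum_(1 <= k < p - j) gregory_abs rat k / (p - j - k)%:R)
   (\sum_(1 <= k < p - j) gregory_abs 'F_p k / (p - j - k)%:R).
  apply: reduces_sum => k; rewrite mem_index_iota => /andP[k0 ltk].
  apply: reduces_mul; first by apply: reduces_gregory_abs => //; lia.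
  by apply: reduces_natV; rewrite natrFp_neq0 //; lia.
have H2 : reduces p ((p - j)%:R^-1) ((p - j)%:R^-1).
  by apply: reduces_natV; rewrite natrFp_neq0 //; lia.
rewrite -E in H2; have := reduces_redp _ _ _ H1; rewrite (reduces_redp _ _ _ H2).
rewrite natrFp_sub ?(ltnW (ltnW ltjp)) // invrN => /(congr1 -%R).
rewrite opprK => ->.
rewrite -sumrN !big_nat; apply: eq_bigr => n /andP[_ ltn].
by rewrite Eneg // invrN mulrN opprK.
Qed.

(** Here the recurrence is taken at p - 1 and contains the term of index p - 1,
    which is not p-integral: with T the integral of X (X-1) ... (X-p+2) without
    its leading monomial, |G_(p-1)| = - (T + 1/p) / (p-1)!. The other terms
    therefore sum to 1/p + (T + 1/p) / (p-1)! = (W + T) / (p-1)!, where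
    W = ((p-1)! + 1) / p. Over F_p the last term is - T / (p-1)! = T, divided by
    p - 1 = -1, and T cancels. *)
Lemma sum_gregory_abs_0 :
  \sum_(1 <= n < p) gregory_abs 'F_p n / n%:R = (wilson_quotient p)%:R.
Proof.
pose P := p.-1; have EP : p = P.+1 by rewrite prednK ?prime_gt0.
pose z k : int := (falling_poly int P)`_k.
have zP : z P = 1 by rewrite /z lead_falling_poly.
pose T (F : fieldType) : F := \sum_(0 <= k < P) (z k)%:~R / k.+1%:R.
have p0 : p%:R != 0 :> rat by rewrite pnatr_eq0 -lt0n prime_gt0.
have f0 : P`!%:R != 0 :> rat by rewrite pnatr_eq0 -lt0n fact_gt0.
have GE (F : fieldType) : gregory_abs F P = - (P`!%:R^-1 * (T F + p%:R^-1)).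
  rewrite /gregory_abs /P sign_pred mulN1r integral01_binom_poly -/P.
  rewrite big_nat_recr //= -/(z P) zP.
  by rewrite rmorph1 mul1r -EP.
have P0 : (0 < P)%N by rewrite /P; lia.
have := gregory_abs_rec P P0; rewrite big_nat_recr //= subSnn divr1 -EP GE.
move/(canRL (addrNK _)) => E.
have EW : (wilson_quotient p)%:R = (P`!%:R + 1) / p%:R :> rat.
  by rewrite natr1 -wilson_quotientE natrM mulfK.
have {E} E : \sum_(1 <= k < P) gregory_abs rat k / (p - k)%:R
     = P`!%:R^-1 * ((wilson_quotient p)%:R + T rat).
  by rewrite E EW; field; rewrite p0.
have H1 : reduces p (\sum_(1 <= k < P) gregory_abs rat k / (p - k)%:R)
   (\sum_(1 <= k < P) gregory_abs 'F_p k / (p - k)%:R).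
  apply: reduces_sum => k; rewrite mem_index_iota => /andP[k0 ltk].
  apply: reduces_mul; first by apply: reduces_gregory_abs => //; lia.
  by apply: reduces_natV; rewrite natrFp_neq0 //; lia.
have H2 : reduces p (P`!%:R^-1 * ((wilson_quotient p)%:R + T rat))
   (P`!%:R^-1 * ((wilson_quotient p)%:R + T 'F_p)).
  apply: reduces_mul; first by apply: reduces_natV; rewrite factFp_neq0 //; lia.
  apply: reduces_add; first exact: reduces_nat.
  apply: reduces_sum => k; rewrite mem_index_iota => /andP[k0 ltk].
  apply: reduces_mul; first exact: reduces_int.
  by apply: reduces_natV; rewrite natrFp_neq0 //; lia.
rewrite -E in H2; have := reduces_redp _ _ _ H1; rewrite (reduces_redp _ _ _ H2).
rewrite factFp_pred invrN1 mulN1r => EF.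
have EsP : \sum_(1 <= n < P) gregory_abs 'F_p n / n%:R = (wilson_quotient p)%:R + T 'F_p.
  rewrite -[RHS]opprK EF -sumrN !big_nat; apply: eq_bigr => n /andP[_ ltn].
  by rewrite natrFp_sub //; [rewrite invrN mulrN opprK | lia].
have -> : index_iota 1 p = index_iota 1 P.+1 by rewrite -EP.
rewrite big_nat_recr //= EsP GE factFp_pred pchar_Fp_0 // invr0 addr0.
have -> : P%:R = -1 :> 'F_p by rewrite /P -subn1 natrFp_sub ?prime_gt0.
by rewrite invrN1 mulN1r opprK mulrN1 addrK.
Qed.
End SumAbsG.

(** * Gregory coefficients near p *)

Definition ell (p a : nat) : nat := ((a ^ p - a) %/ p)%N.

Lemma expn_ell p a : prime p -> (a ^ p = p * ell p a + a)%N.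
Proof.
move=> p_pr; have le_a : (a <= a ^ p)%N.
  by case: a => // a; rewrite -[X in (X <= _)%N]expn1 leq_pexp2l // prime_gt0.
rewrite /ell mulnC divnK ?subnK //.
by rewrite -eqn_mod_dvd // fermat_little.
Qed.

(** Because 'C(p - 1, i) / (i + 1) = 'C(p, i + 1) / p, the integral is the
    expansion of ((b+1)^p - b^p - 1) / p; the monomial X^(p-1), which would
    contribute 1 / p, is the one that integrates to 0. *)
Lemma integral01_translate_Xn_pred p b : prime p ->
  integral01 'F_p (('X + b%:R%:P) ^+ p.-1) = (ell p b.+1)%:R - (ell p b)%:R.
Proof.
case: p => // P p_pr; rewrite succnK.
pose d i := ('C(P.+1, i.+1) %/ P.+1)%N.
have dE i : (i < P)%N -> 'C(P.+1, i.+1) = (P.+1 * d i)%N.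
  by move=> ltiP; rewrite mulnC divnK // prime_dvd_bin.
have dE' i : (i < P)%N -> 'C(P, i) = (i.+1 * d i)%N.
  move=> ltiP; apply/eqP; rewrite -(eqn_pmul2l (prime_gt0 p_pr)) mulnCA -dE //.
  by rewrite -mul_bin_diag.
have EN : (ell P.+1 b.+1 = ell P.+1 b + \sum_(i < P) d i * b ^ (P - i))%N.
  apply/eqP; rewrite -(eqn_pmul2l (prime_gt0 p_pr)) mulnDr.
  rewrite -(eqn_add2r b.+1) -expn_ell // -[X in (X ^ _)%N]addn1 expnDn.
  rewrite big_ord_recl big_ord_recr /= bin0 mul1n subn0 exp1n muln1.
  rewrite expn_ell // subnn binn exp1n !muln1 big_distrr /=.
  apply/eqP; set S1 := (\sum_(i < P) _)%N; set S2 := (\sum_(i < P) _)%N.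
  have -> : S1 = S2.
    apply: eq_bigr => i _; have ltiP := ltn_ord i.
    by rewrite /bump add1n dE // exp1n muln1 subSS mulnA.
  by lia.
rewrite EN natrD addrAC subrr add0r natr_sum addrC exprDn raddf_sum.
rewrite big_ord_recr /= [X in _ + X](_ : _ = 0) ?addr0; last first.
  by rewrite subnn expr0 mul1r binn integral01Xn pchar_Fp_0.
apply: eq_bigr => i _; have ltiP := ltn_ord i.
rewrite -polyC_exp mul_polyC raddfMn /= integral01Z integral01Xn dE' //.
rewrite -[_ *+ (_ * _)]mulr_natr !natrM natrX mulrCA mulrA.
by rewrite mulrCA mulfV ?(natrFp_neq0 _ p_pr) // mulr1 mulrC.
Qed.

(** By Wilson and Fermat: (p-1)! = -1, and (X+1)^(p-1) - 1 is monic with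
    the roots 0, ..., p - 2. *)
Lemma binom_poly_pred_Fp p : prime p ->
  binom_poly 'F_p p.-1 = 1 - ('X + 1) ^+ p.-1.
Proof.
move=> p_pr; pose P := p.-1; have EP : p = P.+1 by rewrite prednK ?prime_gt0.
have P0 : (0 < P)%N by have := prime_gt1 p_pr; rewrite EP.
pose f : {poly 'F_p} := ('X + 1) ^+ P - 1.
pose rs : seq 'F_p := [seq a%:R | a <- iota 0 P].
have X1 : 'X + 1 = 'X - (- 1%R)%:P :> {poly 'F_p} by rewrite polyCN opprK.
have ltf : (size ((- 1)%R : {poly 'F_p}) < size (('X + 1 : {poly 'F_p})%R ^+ P)%R)%N.
  by rewrite X1 size_exp_XsubC size_polyN size_poly1.
have szf : size f = (size rs).+1.
  by rewrite size_polyDl // X1 size_exp_XsubC size_map size_iota.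
have lcf : lead_coef f = 1.
  rewrite lead_coefDl // X1; apply/monicP; apply: monic_exp; exact: monicXsubC.
have rootf : all (root f) rs.
  apply/allP => x /mapP[a]; rewrite mem_iota /= add0n => ltaP ->.
  rewrite /root /f !hornerE natr1.
  have a0 : a.+1%:R != 0 :> 'F_p by rewrite natrFp_neq0 //; lia.
  rewrite subr_eq0; apply/eqP; apply: (mulfI a0); rewrite mulr1 -exprS -EP.
  by rewrite -natrX expn_ell // natrD natrM pchar_Fp_0 // mul0r add0r.
have uniqrs : uniq_roots rs.
  rewrite uniq_rootsE map_inj_in_uniq ?iota_uniq // => a b.
  rewrite !mem_iota /= !add0n => lta ltb /(congr1 val) /=.
  rewrite !val_Fp_nat // !modn_small //; lia.
have := all_roots_prod_XsubC szf rootf uniqrs.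
rewrite lcf scale1r big_map => Ef.
rewrite /binom_poly factFp_pred // invrN1 scaleN1r -/P /falling_poly.
rewrite -(big_mkord xpredT (fun i => 'X - (i%:R)%:P)) /index_iota subn0 -Ef.
by rewrite opprB.
Qed.

(** Descent from 'C(X, p - 1): by Pascal's rule, lowering the index by one takes
    the difference of two consecutive translates. *)
Lemma integral01_translate_binom_poly p k a : prime p -> (k < p)%N ->
  integral01 'F_p (binom_poly 'F_p (p.-1 - k) \Po ('X + a%:R%:P))
   = (k == 0%N)%:R - iter k.+1 fwd_diff (fun b => (ell p b)%:R) a.+1.
Proof.
move=> p_pr; elim: k a => [|k IHk] a ltkp.
  rewrite subn0 binom_poly_pred_Fp // comp_polyB rmorphXn /= comp_polyD comp_polyX.
  rewrite rmorph1 -addrA -polyCD natr1 raddfB /= integral01_translate_Xn_pred //.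
  by rewrite -(expr0 'X) integral01Xn invr1.
have En : (p.-1 - k = (p.-1 - k.+1).+1)%N by lia.
have n0 : (p.-1 - k)%:R != 0 :> 'F_p by rewrite natrFp_neq0 //; lia.
have -> : binom_poly 'F_p (p.-1 - k.+1)
    = binom_poly 'F_p (p.-1 - k) \Po ('X + 1) - binom_poly 'F_p (p.-1 - k).
  by rewrite En in n0 *; rewrite binom_poly_shift // addrAC subrr add0r.
rewrite comp_polyB raddfB /= -comp_polyA comp_polyD comp_polyX.
rewrite rmorph1 -addrA -polyCD natr1 !IHk ?(ltnW ltkp) //.
set s := iter k.+1 _ _.
by rewrite [X in 0 - X](_ : _ = s a.+2 - s a.+1) //; ring.
Qed.

Lemma gregory_abs_complement p i : prime p -> (2 < p)%N -> (0 < i <= p)%N ->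
  gregory_abs 'F_p (p - i)
   = (-1) ^+ i.-1 * (iter i fwd_diff (fun b => (ell p b)%:R) 1 - (i == 1%N)%:R).
Proof.
move=> p_pr p_odd; case: i => // i /andP[_ ltip].
have Ei : (p - i.+1 = p.-1 - i)%N by lia.
have := integral01_translate_binom_poly p i 0 p_pr ltip.
rewrite addr0 comp_polyXr eqSS /gregory_abs Ei => ->.
have -> : (-1) ^+ (p.-1 - i) = (-1) ^+ i :> 'F_p.
  apply: (mulIf (x := (-1) ^+ i)); first by rewrite signr_eq0.
  rewrite -exprD subnK; last by lia.
  by rewrite sign_pred // -expr2 sqrr_sign.
by rewrite mulNr -mulrN opprB.
Qed.

(** * Assembly in the ring of residues modulo almost all primes *)

Lemma toA0 : toA (fun=> 0) = 0.
Proof. by rewrite [RHS]piE. Qed.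

Lemma toAB (f g : prodFp) : toA f - toA g = toA (fun p => f p - g p).
Proof.
apply/eqP; rewrite subr_eq toAD; apply/eqP/toA_eqP.
by exists 0%N => p _; rewrite subrK.
Qed.

Lemma toA_sum (I : Type) (r : seq I) (P : pred I) (f : I -> prodFp) :
  \sum_(i <- r | P i) toA (f i) = toA (fun p => \sum_(i <- r | P i) f i p).
Proof.
elim: r => [|i r IHr].
  by rewrite big_nil -toA0; apply/toA_eqP; exists 0%N => p _; rewrite big_nil.
rewrite big_cons IHr; case Pi: (P i); rewrite ?toAD;
  by apply/toA_eqP; exists 0%N => p _; rewrite big_cons Pi.
Qed.

Lemma toAZ (c : rat) (f : prodFp) :
  c *: toA f = toA (fun p => redp (val p) c * f p).
Proof. by rewrite -toAM -mulr_algl alg_ratA. Qed.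

Lemma iter_fwd_diff_toA i a (f : nat -> prodFp) :
  iter i fwd_diff (fun b => toA (f b)) a
   = toA (fun p => iter i fwd_diff (fun b => f b p) a).
Proof. by elim: i a => //= i IHi a; rewrite /fwd_diff !IHi toAB. Qed.

(** For p > a the component a (a^(p-1) - 1) / p is the integer (a^p - a) / p. *)
Lemma ellA_nat a : (0 < a)%N -> ellA a%:R = toA (fun p => (ell (val p) a)%:R).
Proof.
move=> a0; rewrite /ellA /logA toAZ; apply/toA_eqP; exists a => p ltap.
have p_pr := valP p; have p0 := prime_gt0 p_pr.
have a0' : a%:R != 0 :> 'F_(val p) by rewrite (natrFp_neq0 _ p_pr) ?a0.
have a0q : a%:R != 0 :> rat by rewrite pnatr_eq0 -lt0n.
have p0q : (val p)%:R != 0 :> rat by rewrite pnatr_eq0 -lt0n.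
have -> : fermat_quotient (val p) a%:R = (ell (val p) a)%:R / a%:R.
  apply: (mulIf a0q); rewrite divfK // /fermat_quotient.
  apply: (mulfI p0q); rewrite mulrA [_ * (_ / _)]mulrC divfK // mulrBl mul1r.
  rewrite -exprSr prednK // -natrX expn_ell // natrD natrM addrK //.
have Ha : reduces (val p) a%:R a%:R := reduces_nat _ a.
have H : reduces (val p) ((ell (val p) a)%:R / a%:R) ((ell (val p) a)%:R / a%:R).
  by apply: reduces_mul; [apply: reduces_nat | apply: reduces_natV].
by rewrite (reduces_redp _ _ _ Ha) (reduces_redp _ _ _ H) mulrC divfK.
Qed.

(** Both sides are, up to the sign (-1)^m, the m-th forward difference of 1 / k
    at k = n. *)
Lemma partial_fractions m n : (0 < n)%N ->
  m`!%:R / \prod_(0 <= i < m.+1) (n + i)%:R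
   = \sum_(j < m.+1) ((-1) ^+ j * 'C(m, j)%:R) / (n + j)%:R :> rat.
Proof.
move=> n0; have := iter_fwd_diff_newton _ rat^o (fun k => k%:R^-1) m m.+1 n (ltnSn m).
rewrite iter_fwd_diff_inv // => E.
transitivity ((-1) ^+ m * ((-1) ^+ m * m`!%:R / \prod_(0 <= i < m.+1) (n + i)%:R) : rat).
  by rewrite !mulrA -expr2 sqrr_sign mul1r.
rewrite E mulr_sumr; apply: eq_bigr => j _.
rewrite -[_ *: _]/(_ * _) exprD !mulrA -expr2 sqrr_sign mul1r //.
Qed.

(** The range depends on m alone, so that the sums for the various j can be
    combined by [partial_fractions]. *)
Definition gregory_sum (m j : nat) : calA :=
  toA (fun p => \sum_(1 <= n < val p - m) gregory_abs 'F_(val p) n / (n + j)%:R).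

Lemma gammaK_sum_decomposition m : (0 < m)%N ->
  toA (fun p => redp (val p) (gammaK_sum m (val p)))
   = \sum_(j < m.+1) ((-1) ^+ j * 'C(m, j)%:R) *: gregory_sum m j.
Proof.
move=> m0; under eq_bigr do rewrite toAZ.
rewrite toA_sum; apply/toA_eqP; exists m.+1 => p ltmp.
have p_pr := valP p; set q := val p in p_pr ltmp *.
have -> : gammaK_sum m q = \sum_(j < m.+1) ((-1) ^+ j * 'C(m, j)%:R)
     * \sum_(1 <= n < q - m) gregory_abs rat n / (n + j)%:R.
  rewrite /gammaK_sum mulr_sumr.
  under [RHS]eq_bigr do rewrite mulr_sumr.
  rewrite exchange_big /=; apply: eq_big_nat => n /andP[n0 _].
  rewrite norm_gregory // mulrCA partial_fractions // mulr_sumr.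
  by apply: eq_bigr => j _; rewrite mulrCA.
have Hc (j : nat) : reduces q ((-1) ^+ j * 'C(m, j)%:R) ((-1) ^+ j * 'C(m, j)%:R).
  by apply: reduces_mul; [apply: reduces_sign | apply: reduces_nat].
apply: reduces_redp; apply: reduces_sum => j _.
rewrite (reduces_redp _ _ _ (Hc j)); apply: reduces_mul; first exact: Hc.
have ltjm := ltn_ord j.
apply: reduces_sum => n; rewrite mem_index_iota => /andP[n0 ltn].
apply: reduces_mul; first by apply: reduces_gregory_abs => //; lia.
by apply: reduces_natV; rewrite (natrFp_neq0 _ p_pr) //; lia.
Qed.

Lemma sum_nat_complement (V : zmodType) (F : nat -> V) p j m : (j <= m <= p)%N ->
  \sum_(p - m <= n < p - j) F n = \sum_(j.+1 <= i < m.+1) F (p - i)%N.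
Proof.
elim: m => [|m IHm] /andP[lejm lemp].
  by rewrite !big_geq //; lia.
have [lt_mj|le_jm] := ltnP m j; first by rewrite !big_geq //; lia.
rewrite big_nat_recr // -IHm ?le_jm ?(ltnW lemp) //= addrC.
rewrite big_ltn; last by lia.
by congr (_ + \sum_(_ <= i < _) _); lia.
Qed.

(** The sum over n < p - j is known; the terms with p - m <= n < p - j are
    indexed by i = p - n, with n + j = - (i - j) modulo p. *)
Lemma gregory_sumE m j : (j <= m)%N ->
  gregory_sum m j = (if j == 0%N then gammaW else 0) + (j%:R^-1)%:A
   + \sum_(j.+1 <= i < m.+1) ((-1) ^+ i.-1 / (i - j)%:R)
       *: (iter i fwd_diff (fun a => ellA a.+1%:R) 0 - (i == 1%N)%:R).
Proof.
move=> lejm.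
have E1 (i : nat) : iter i fwd_diff (fun a => ellA a.+1%:R) 0 - (i == 1%N)%:R =
    toA (fun p => iter i fwd_diff (fun b => (ell (val p) b)%:R) 1 - (i == 1%N)%:R).
  have -> : (i == 1%N)%:R = toA (fun=> (i == 1%N)%:R).
    by case: (i == 1%N); rewrite ?toA1 ?toA0.
  have -> : (fun a => ellA a.+1%:R) = (fun a => toA (fun p => (ell (val p) a.+1)%:R)).
    by apply/boolp.funext => a; rewrite ellA_nat.
  rewrite iter_fwd_diff_toA toAB; apply/toA_eqP; exists 0%N => p _.
  by rewrite (iter_fwd_diff_shift _ (fun b => (ell (val p) b)%:R)).
have -> : (if j == 0%N then gammaW else 0)
    = toA (fun p => if j == 0%N then (wilson_quotient (val p))%:R else 0).
  by case: (j == 0%N); rewrite ?toA0.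
under eq_bigr do rewrite E1 toAZ.
rewrite alg_ratA /ratA toAD toA_sum toAD; apply/toA_eqP.
exists m.+2 => p ltmp; have p_pr := valP p; set q := val p in p_pr ltmp *.
have q2 : (2 < q)%N by lia.
have redV k : (k < q)%N -> redp q k%:R^-1 = k%:R^-1.
  move=> ltkq; have [->|k0] := eqVneq k 0%N.
    by rewrite !invr0; apply: (reduces_redp _ _ _ (reduces_nat _ 0)).
  apply/reduces_redp/reduces_natV; rewrite (natrFp_neq0 _ p_pr) //; lia.
have -> : (if j == 0%N then (wilson_quotient q)%:R else 0) + redp q j%:R^-1
    = \sum_(1 <= n < q - j) gregory_abs 'F_q n / (n + j)%:R.
  rewrite redV; last by lia.
  case: eqVneq => [->|j0].
    rewrite invr0 addr0 subn0 -(sum_gregory_abs_0 _ p_pr q2).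
    by apply: eq_bigr => n _; rewrite addn0.
  by rewrite add0r sum_gregory_abs_pos //; lia.
rewrite [X in _ = X + _](big_cat_nat (n := q - m)) /=; [|lia|lia].
rewrite -addrA sum_nat_complement; last by lia.
rewrite -big_split /= -[LHS]addr0; congr (_ + _).
rewrite big_nat big1 // => i /andP[ltji leim].
rewrite (gregory_abs_complement _ _ p_pr q2); last by lia.
have -> : redp q ((-1) ^+ i.-1 / (i - j)%:R) = (-1) ^+ i.-1 / (i - j)%:R.
  apply/reduces_redp/reduces_mul; first exact: reduces_sign.
  by apply: reduces_natV; rewrite (natrFp_neq0 _ p_pr) //; lia.
have -> : (q - i + j)%:R = - (i - j)%:R :> 'F_q.
  rewrite -(natrFp_sub _ p_pr) //; last by lia.
  by congr (_%:R); lia.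
by rewrite invrN mulrN mulrAC addNr.
Qed.

(** After exchanging the sums over j and i, the coefficient of the i-th forward
    difference is \sum_(j < i) (-1)^j 'C(m, j) (-1)^(i-1) / (i - j), the
    derivative of 'C(X, i) at m by [deriv_binom_poly_nat_log]. *)
Lemma gammaK_sum_newton m : (0 < m)%N ->
  toA (fun p => redp (val p) (gammaK_sum m (val p)))
   = gammaW - (harmonic m)%:A - 1
     + \sum_(i < m.+1) (binom_poly rat i)^`().[m%:R]
         *: iter i fwd_diff (fun a => ellA a.+1%:R) 0.
Proof.
move=> m0; rewrite gammaK_sum_decomposition //.
pose x (i : nat) : calA := iter i fwd_diff (fun a => ellA a.+1%:R) 0 - (i == 1%N)%:R.
pose c (j : nat) : rat := (-1) ^+ j * 'C(m, j)%:R.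
transitivity (\sum_(j < m.+1) (c j *: (if j == 0%N :> nat then gammaW else 0)
    + (c j / j%:R)%:A
    + \sum_(i < m.+1 | (j < i)%N) (c j * ((-1) ^+ i.-1 / (i - j)%:R)) *: x i)).
  apply: eq_bigr => j _; rewrite gregory_sumE; last by rewrite -ltnS.
  rewrite !scalerDr scalerA big_geq_mkord; congr (_ + _); rewrite scaler_sumr.
  by apply: eq_bigr => i _; rewrite scalerA.
rewrite !big_split /= -scaler_suml (sum_bin_inv m) scaleNr.
rewrite big_ord_recl /= [X in _ + X - _]big1 ?addr0 => [|i _]; last by rewrite scaler0.
rewrite {1}/c expr0 mul1r bin0 scale1r -!addrA; congr (_ + (_ + _)).
rewrite (exchange_big_dep xpredT) //=.
transitivity (\sum_(i < m.+1) (binom_poly rat i)^`().[m%:R] *: x i).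
  apply: eq_bigr => i _; rewrite -scaler_suml; congr (_ *: _).
  case: i => -[|i] ltim /=.
    by rewrite binom_poly0 derivC horner0 big1.
  rewrite deriv_binom_poly_nat_log //.
  rewrite (big_ord_widen m.+1 (fun j =>
    (-1) ^+ (i.+1.-1 - j) / (i.+1 - j)%:R * 'C(m, j)%:R)); last by lia.
  apply: eq_bigr => j ltji; rewrite /c /=.
  have -> : (-1) ^+ (i - j) = (-1) ^+ j * (-1) ^+ i :> rat.
    have leji : (j <= i)%N by [].
    by rewrite -{2}(subnK leji) exprD mulrCA -expr2 sqrr_sign mulr1.
  by ring.
have b_x (i : 'I_m.+1) : true -> (binom_poly rat i)^`().[m%:R] *: x i =
    (binom_poly rat i)^`().[m%:R] *: iter i fwd_diff (fun a => ellA a.+1%:R) 0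
    - (binom_poly rat i)^`().[m%:R] *: (i == 1%N :> nat)%:R.
  by move=> _; rewrite -scalerBr.
rewrite (eq_bigr _ b_x) sumrB addrC; congr (_ + _); congr (- _).
(* the correction at i = 1 has weight m (H_m - H_(m-1)) = 1 *)
have lt1m : (1 < m.+1)%N by [].
rewrite (bigD1 (Ordinal lt1m)) //= big1 ?addr0 => [|i i1].
  rewrite deriv_binom_poly_nat // bin1 -{2}[m]prednK // harmonicS subn1.
  rewrite prednK // addrAC subrr add0r mulfV ?scale1r // pnatr_eq0 -lt0n //.
have /negbTE -> : (i != 1 :> nat)%N by [].
by rewrite scaler0.
Qed.

Lemma ellA1 : ellA 1 = 0.
Proof.
rewrite (ellA_nat 1) // -toA0; apply/toA_eqP; exists 0%N => p _.
by rewrite /ell exp1n subnn div0n.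
Qed.

Theorem theorem4p2 (m : nat) (hm : (1 <= m)%N) :
  gammaK m =
    gammaW - 1 + (harmonic m - 1) *: ellA m.+1%:R
    + \sum_(1 <= j < m)
        ((-1) ^+ (m - j) * 'C(m, j)%:R / (m - j)%:R) *: ellA j.+1%:R
  :> calA.
Proof.
rewrite /gammaK gammaK_sum_newton // deriv_newton_interpolation.
rewrite -(big_mkord xpredT (fun l => ((-1) ^+ (m - l) * 'C(m, l)%:R / (m - l)%:R)
  *: ellA l.+1%:R)) big_ltn // ellA1 scaler0 add0r scalerBl scale1r.
set S := \sum_(1 <= j < m) _; set H := (harmonic m)%:A; set L := ellA _.
by ring.
Qed.
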